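(* Let $(X,\sigma_m)$ be a modified metric-like space. Then: 1. If a sequence $\{x_n\}$ in $X$ is symmetric convergent to $x\in X$ (written $x_n\rightarrow^s x$), then $\{x_n\}$ is $\sigma_m$-Cauchy. 2. If $\{x_n\}$ is a $\sigma_m$-Cauchy sequence in $X$ and has a subsequence $\{x_{n_i}\}$ such that $x_{n_i}\rightarrow^s x$ for some $x\in X$, then $x_n\rightarrow^s x$. 3. If $\{x_n\}$ and $\{y_n\}$ are $\sigma_m$-Cauchy sequences in $X$, then $\lim_{n\rightarrow\infty}\sigma_m(x_n,y_n)$ exists. 4. If $x_n\rightarrow^s x$ and $y_n\rightarrow^s y$ with $x,y\in X$, then $\lim_{n\rightarrow\infty}\sigma_m(x_n,y_n)=\sigma_m(x,y)$.
   Context: A modified metric-like space is a pair $(X,\sigma_m)$ where $X$ is a nonempty set and $\sigma_m:X\times X\rightarrow[0,\infty)$ satisfies, for all $x,y,z\in X$: (i) $\sigma_m(x,y)=0$ implies $x=y$; (ii) $\sigma_m(x,y)=\sigma_m(y,x)$; (iii) $\sigma_m(x,y)\le\sigma_m(x,z)+\sigma_m(z,y)-\sigma_m(z,z)$. (The self-distance $\sigma_m(x,x)$ need not be zero.) For $x\in X$ and $\delta>0$ put $B_{\sigma_m}(x,\delta)=\{y\in X:|\sigma_m(x,y)-\sigma_m(x,x)|<\delta\}$. A sequence $\{x_n\}$ in $X$ is symmetric convergent to $x\in X$, written $x_n\rightarrow^s x$, if for every $\epsilon>0$ there exists $n_0\in\mathbb{N}$ such that for all $n\ge n_0$ one has $x_n\in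 B_{\sigma_m}(x,\epsilon)$ and $x\in B_{\sigma_m}(x_n,\epsilon)$; equivalently, $\lim_{n\to\infty}\sigma_m(x_n,x)=\lim_{n\to\infty}\sigma_m(x_n,x_n)=\sigma_m(x,x)$. A sequence $\{x_n\}$ in $X$ is $\sigma_m$-Cauchy if the double limit $\lim_{n,l\rightarrow\infty}\sigma_m(x_n,x_l)$ exists and is finite. *)

(* Defs.v *)
From HB Require Import structures.
From mathcomp Require Import all_boot all_order all_algebra.
From mathcomp Require Import all_classical all_reals all_analysis.
Set Implicit Arguments.
Unset Strict Implicit.
Unset Printing Implicit Defensive.
Import Order.TTheory GRing.Theory Num.Theory.
Import numFieldNormedType.Exports.
Local Open Scope classical_set_scope.
Local Open Scope ring_scope.

(* The converse of [mml_eq0] is deliberately absent: self-distances may be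
   positive. *)
Record modified_metric_like (R : realType) (X : Type) (sigma : X -> X -> R)
    : Prop := ModifiedMetricLike {
  mml_nonempty : inhabited X;
  mml_ge0 : forall x y, 0 <= sigma x y;
  mml_eq0 : forall x y, sigma x y = 0 -> x = y;
  mml_sym : forall x y, sigma x y = sigma y x;
  mml_triangle : forall x y z,
    sigma x y <= sigma x z + sigma z y - sigma z z }.

Definition mml_ball (R : realType) (X : Type) (sigma : X -> X -> R)
    (x : X) (delta : R) : set X :=
  [set y | `|sigma x y - sigma x x| < delta].

(* Balls are not symmetric: [mml_ball sigma x e (u n)] bounds the distance of
   [sigma x (u n)] to [sigma x x], whereas [mml_ball sigma (u n) e x] bounds
   its distance to [sigma (u n) (u n)]. *)
Definition sym_cvg (R : realType) (X : Type) (sigma : X -> X -> R)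
    (u : nat -> X) (x : X) : Prop :=
  forall e : R, 0 < e -> exists n0 : nat, forall n : nat, (n0 <= n)%N ->
    mml_ball sigma x e (u n) /\ mml_ball sigma (u n) e x.

(* The double limit is taken along the product filter: both indices tend to
   infinity independently. The limit ranges over [R], so it is finite. *)
Definition mml_cauchy (R : realType) (X : Type) (sigma : X -> X -> R)
    (u : nat -> X) : Prop :=
  exists L : R,
    (fun p : nat * nat => sigma (u p.1) (u p.2)) @ (\oo, \oo) --> L.

(* Main.v *)
(* Call a and c e-close when each lies in the e-ball of the other. The modified
   triangle inequality says that replacing a by an e-close c and b by an f-close
   d changes sigma a b by less than e + f. Terms of a symmetrically convergent
   sequence are eventually close to its limit, and terms of a Cauchy sequence,
   whose self-distances share the double limit, are eventually close to each
   other; all four claims are instances of this estimate. *)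
Require Import Defs.
From HB Require Import structures.
From mathcomp Require Import all_boot all_order all_algebra.
From mathcomp Require Import all_classical all_reals all_analysis.
From mathcomp Require Import lra.
Set Implicit Arguments.
Unset Strict Implicit.
Unset Printing Implicit Defensive.
Import Order.TTheory GRing.Theory Num.Theory.
Import numFieldNormedType.Exports.
Local Open Scope classical_set_scope.
Local Open Scope ring_scope.

(** The triangle inequality through [d] bounds the difference above, the one through [b] bounds it
    below; each subtracted self-distance is absorbed by one of the two ball conditions. *)
Lemma sigma_close_right (R : realType) (X : Type) (sigma : X -> X -> R)
    (hsigma : modified_metric_like sigma) (a b d : X) (e : R) :
  mml_ball sigma b e d -> mml_ball sigma d e b ->
  `|sigma a b - sigma a d| < e.
Proof.
rewrite /mml_ball /= (mml_sym hsigma d b) !ltr_norml.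
move=> /andP[_ hb] /andP[_ hd].
have hab := mml_triangle hsigma a b d; have had := mml_triangle hsigma a d b.
rewrite (mml_sym hsigma d b) in hab.
by apply/andP; split; lra.
Qed.

Lemma sigma_close (R : realType) (X : Type) (sigma : X -> X -> R)
    (hsigma : modified_metric_like sigma) (a b c d : X) (e f : R) :
  mml_ball sigma a e c -> mml_ball sigma c e a ->
  mml_ball sigma b f d -> mml_ball sigma d f b ->
  `|sigma a b - sigma c d| < e + f.
Proof.
move=> ac ca bd db.
have h1 := sigma_close_right hsigma c bd db.
have := sigma_close_right hsigma b ac ca.
rewrite !(mml_sym hsigma b) => h2.
by apply: le_lt_trans (ler_distD (sigma c b) _ _) (ltrD h2 h1).
Qed.

(** Both [sigma (u n) (u m)] and the self-distance [sigma (u n) (u n)] lie within [e / 2] of the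
    double limit. Swapping [n] and [m] gives the reverse membership. *)
Lemma cauchy_mutual_ball (R : realType) (X : Type) (sigma : X -> X -> R)
    (u : nat -> X) (e : R) :
  mml_cauchy sigma u -> 0 < e ->
  exists N : nat, forall n m : nat, (N <= n)%N -> (N <= m)%N ->
    mml_ball sigma (u n) e (u m).
Proof.
move=> [L /cvgrPdist_lt uL] e0.
have e20 : 0 < e / 2 by rewrite divr_gt0.
have [[A B] [[N1 _ hA] [N2 _ hB]] AB] := uL _ e20.
have close n m : (maxn N1 N2 <= n)%N -> (maxn N1 N2 <= m)%N ->
    `|L - sigma (u n) (u m)| < e / 2.
  rewrite !geq_max => /andP[n1 n2] /andP[m1 m2].
  by apply: (AB (n, m)); split; [exact: hA | exact: hB].
exists (maxn N1 N2) => n m hn hm; rewrite /mml_ball /= [e]splitr.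
apply: le_lt_trans (ler_distD L _ _) _.
by rewrite ltrD ?close // distrC close.
Qed.

Theorem theorem1 (R : realType) (X : Type) (sigma : X -> X -> R)
    (hsigma : modified_metric_like sigma) :
  [/\ (forall (u : nat -> X) (x : X), sym_cvg sigma u x -> mml_cauchy sigma u),
      (forall (u : nat -> X) (phi : nat -> nat) (x : X),
         mml_cauchy sigma u -> increasing_seq phi ->
         sym_cvg sigma (u \o phi) x -> sym_cvg sigma u x),
      (forall u v : nat -> X, mml_cauchy sigma u -> mml_cauchy sigma v ->
         exists L : R, (fun n => sigma (u n) (v n)) @ \oo --> L) &
      (forall (u v : nat -> X) (x y : X),
         sym_cvg sigma u x -> sym_cvg sigma v y ->
         (fun n => sigma (u n) (v n)) @ \oo --> sigma x y)].
Proof.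
split.
- move=> u x ux; exists (sigma x x); apply/cvgrPdist_lt => e e0.
  have [N hN] := ux _ (divr_gt0 e0 (ltr0n R 2)).
  exists ([set n | (N <= n)%N], [set n | (N <= n)%N]).
    by split; exists N.
  move=> [n m] /= [/hN[xn nx] /hN[xm mx]].
  by rewrite [e]splitr; exact: sigma_close.
- move=> u phi x uc phi_incr ux e e0.
  have e20 : 0 < e / 2 by rewrite divr_gt0.
  have [N1 hN1] := cauchy_mutual_ball uc e20.
  have [N2 hN2] := ux _ e20.
  exists N1 => n hn.
  (* Since [phi k >= k], this choice puts [phi k] beyond [N1], while [k >= N2] makes [u (phi k)]
     close to [x]. *)
  pose k := maxn n N2.
  have [xk kx] := hN2 k (leq_maxr _ _).
  have hk : (N1 <= phi k)%N.
    apply: leq_trans hn _; apply: leq_trans (leq_maxl n N2) _.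
    exact: unstable.mono_leq_infl.
  have nk := hN1 _ _ hn hk; have kn := hN1 _ _ hk hn.
  (* In both halves the first argument stays fixed and the second moves through [u (phi k)]. *)
  rewrite /mml_ball /= [e]splitr; split.
    apply: le_lt_trans (ler_distD (sigma x (u (phi k))) _ _) _.
    exact: ltrD (sigma_close_right hsigma _ nk kn) xk.
  apply: le_lt_trans (ler_distD (sigma (u n) (u (phi k))) _ _) _.
  exact: ltrD (sigma_close_right hsigma _ xk kx) nk.
(* No candidate limit is at hand, so completeness of the reals supplies it: for each [e], some ball
   of radius [e] must contain a tail. *)
- move=> u v uc vc; apply/cvg_ex/cauchy_cvgP/cauchy_exP => e e0.
  have e20 : 0 < e / 2 by rewrite divr_gt0.
  have [N1 hN1] := cauchy_mutual_ball uc e20.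
  have [N2 hN2] := cauchy_mutual_ball vc e20.
  pose N := maxn N1 N2.
  have N1N : (N1 <= N)%N := leq_maxl _ _; have N2N : (N2 <= N)%N := leq_maxr _ _.
  (* The term at index [N] serves as the centre of that ball. *)
  exists (sigma (u N) (v N)); exists N => // n /= hn.
  have n1 := leq_trans N1N hn; have n2 := leq_trans N2N hn.
  by rewrite -ball_normE /= [e]splitr; apply: sigma_close => //; auto.
- move=> u v x y ux vy; apply/cvgrPdist_lt => e e0.
  have e20 : 0 < e / 2 by rewrite divr_gt0.
  have [N1 hN1] := ux _ e20; have [N2 hN2] := vy _ e20.
  exists (maxn N1 N2) => // n /=.
  rewrite geq_max => /andP[/hN1[xn nx] /hN2[yn ny]].
  by rewrite [e]splitr; exact: sigma_close.
Qed.
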